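(* In the normal-cell setting described in the context (with global integrability and separation), let $I(z)=\int_Na\,e^{-zf}\,\mathrm{dvol}_g$. Suppose that for each $\alpha\in\mathcal A$ there are numbers $Q_\alpha\ge0$ and $K_\alpha\in\mathbb C$ such that, as $z\to\infty$, $$I_\alpha(z)=e^{-zf_0}z^{-Q_\alpha}\bigl(K_\alpha+o(1)\bigr).$$ Let $$Q_*:=\min_{\alpha\in\mathcal A}Q_\alpha,\qquad K_*:=\sum_{\alpha:\,Q_\alpha=Q_*}K_\alpha .$$ Then $$I(z)=e^{-zf_0}\sum_{\alpha\in\mathcal A}z^{-Q_\alpha}\bigl(K_\alpha+r_\alpha(z)\bigr)+O\bigl(e^{-z(f_0+\delta_\varepsilon)}\bigr)\qquad(z\to\infty),$$ where $r_\alpha(z)\to0$ for every $\alpha$. If $K_*\ne0$, then $I(z)\sim e^{-zf_0}z^{-Q_*}K_*$. If $K_*=0$, then $I(z)=o(e^{-zf_0}z^{-Q_*})$.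
   Context: Setting. $(N,g)$ is a $C^2$ Riemannian manifold of dimension $n$ with Riemannian volume measure $\mathrm{dvol}_g$; $f:N\to\mathbb R$ is continuous and bounded below; $a:N\to\mathbb C$ is measurable; $f_0:=\inf_Nf$; $M:=\{x\in N:f(x)=f_0\}$ is nonempty and compact. $\mathcal T_\varepsilon(M):=\{x:\operatorname{dist}_g(x,M)<\varepsilon\}$; $B_r$ is the open Euclidean ball of radius $r$ at $0$ in the relevant dimension. $M=\bigsqcup_{j=0}^{\ell}\Sigma_j$ is a disjoint union of finitely many $C^2$ embedded strata, $\Sigma_j$ a (possibly empty or disconnected) $j$-dimensional submanifold. Global integrability and separation. There is $z_*>0$ with $\int_N|a|e^{-z_*f}\,\mathrm{dvol}_g<\infty$, and for every sufficiently small $\varepsilon>0$ there is $\delta_\varepsilon>0$ with $f(x)\ge f_0+\delta_\varepsilon$ for all $x\in N\setminus\mathcal T_\varepsilon(M)$. Normal-cell decomposition. There are a (sufficiently small) $\varepsilon>0$ and a finite index set $\mathcal A$, and for each $\alpha\in\mathcal A$: a Borel set $P_\alpha\subset\Sigma_{j_\alpha}$ of finite $j_\alpha$-dimensional Riemannian volume, with $M=\bigsqcup_\alpha P_\alpha$; an open neighborhood $U_\alpha$ of $P_\alpha$ in $\Sigma_{j_\alpha}$; $d_\alpha:=n-j_\alpha$; a $C^1$ map $F_\alpha:U_\alpha\times B_\varepsilon\to N$ with $F_\alpha(p,0)=p$; and sets (cells) $\mathsf A_\alpha(p)\subset\mathbb R^{d_\alpha}$, $p\in P_\alpha$, with measurable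 graph $\{(p,s):s\in\mathsf A_\alpha(p)\}$. With $\mathfrak D_\alpha(\varepsilon):=\{(p,s):p\in P_\alpha,\ s\in\mathsf A_\alpha(p)\cap B_\varepsilon\}$, the sets $F_\alpha(\mathfrak D_\alpha(\varepsilon))$ are pairwise disjoint up to null sets and cover $\mathcal T_\varepsilon(M)$ up to a null set, and there are measurable $J_\alpha:\mathfrak D_\alpha(\varepsilon)\to(0,\infty)$ such that for every nonnegative measurable $h$ $$\int_{F_\alpha(\mathfrak D_\alpha(\varepsilon))}h\,\mathrm{dvol}_g=\int_{P_\alpha}\int_{\mathsf A_\alpha(p)\cap B_\varepsilon}h(F_\alpha(p,s))J_\alpha(p,s)\,ds\,\mathrm{dvol}_{P_\alpha}(p).$$ Here $\mathrm{dvol}_{P_\alpha}$ is the induced $j_\alpha$-dimensional Riemannian volume. If $d_\alpha=0$, then $\mathbb R^0=\{0\}$, $\mathsf A_\alpha(p)=\{0\}$, $\mathfrak D_\alpha(\varepsilon)=P_\alpha\times\{0\}$, $F_\alpha(p,0)=p$, $J_\alpha(p,0)=1$, and the fiber integral is evaluation at $0$. (As in the paper's use, the covered region is identified with $\mathcal T_\varepsilon(M)$, so that $\int_{\mathcal T_\varepsilon(M)}a e^{-zf}\,\mathrm{dvol}_g=\sum_\alpha I_\alpha(z)$.) For $z>0$ put $$I_\alpha(z):=\int_{P_\alpha}\int_{\mathsf A_\alpha(p)\cap B_\varepsilon}a(F_\alpha(p,s))J_\alpha(p,s)e^{-zf(F_\alpha(p,s))}\,ds\,\mathrm{dvol}_{P_\alpha}(p).$$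 *)

(* Defs.v *)
From HB Require Import structures.
From mathcomp Require Import all_boot all_order all_algebra.
From mathcomp Require Import all_classical all_reals all_analysis measurable_realfun.
From mathcomp Require Import complex.
Set Implicit Arguments.
Unset Strict Implicit.
Unset Printing Implicit Defensive.
Import Order.TTheory GRing.Theory Num.Theory.
Import numFieldNormedType.Exports.
Local Open Scope classical_set_scope.
Local Open Scope ring_scope.
Local Open Scope complex_scope.

(* needed by the Landau notations at +oo *)
Canonical pinfty_filter_on (R : numFieldType) := FilterType (pinfty_nbhs R) _.

Definition borel (T : ptopologicalType) := g_sigma_algebraType (@open T).

(* R^n is 'rV[R]_n with the product sigma-algebra, generated by the coordinate
   functions; it is the Borel sigma-algebra of R^n. *)
Definition measure_rV_display : measure_display -> measure_display.
Proof. exact. Qed.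

Section measurable_rV.
Context {d} {T : measurableType d} (n : nat).
Let coors : 'I_n -> 'rV[T]_n -> T := fun i x => x ord0 i.
Let rV_set0 : g_sigma_preimage coors set0.
Proof. exact: sigma_algebra0. Qed.
Let rV_setC A : g_sigma_preimage coors A -> g_sigma_preimage coors (~` A).
Proof. exact: sigma_algebraC. Qed.
Let rV_bigcup (F : (set _)^nat) : (forall i, g_sigma_preimage coors (F i)) ->
  g_sigma_preimage coors (\bigcup_i (F i)).
Proof. exact: sigma_algebra_bigcup. Qed.
HB.instance Definition _ := @isMeasurable.Build (measure_rV_display d)
  'rV[T]_n (g_sigma_preimage coors) rV_set0 rV_setC rV_bigcup.
End measurable_rV.

Lemma measurable_coord d (T : measurableType d) n (i : 'I_n) :
  measurable_fun setT (fun v : 'rV[T]_n => v ord0 i).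
Proof.
move=> _ A mA; apply: sub_sigma_algebra.
case: n i => [[]//|n] i.
rewrite -bigcup_mkord_ord; exists i; first exact: ltn_ord.
by exists A => //; rewrite inord_val.
Qed.

Lemma measurable_fun_rVP d d1 (T1 : measurableType d1) (T : measurableType d) n
    (f : T1 -> 'rV[T]_n) :
  (forall i, measurable_fun setT (fun x => f x ord0 i)) ->
  measurable_fun setT f.
Proof.
move=> mf.
suff: g_sigma_preimage (fun i x => f x ord0 i) `<=` measurable.
  move=> H _ A mA; apply: H.
  by rewrite (g_sigma_preimage_comp (fun i (v : 'rV[T]_n) => v ord0 i)); exists A.
apply: smallest_sub; first exact: sigma_algebra_measurable.
case: n => [|n] in f mf *; first by rewrite big_ord0.
rewrite -bigcup_mkord_ord; apply: bigcup_sub => i Ii.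
by move=> A [B mB <-]; exact: mf.
Qed.

Section lebesgue_rV.
Context {R : realType}.

Let dirac_sigma_finite :
  sigma_finite setT (\d_(0 : 'rV[R]_0) : set 'rV[R]_0 -> \bar R).
Proof.
by apply: fin_num_fun_sigma_finite; rewrite ?measure0//; exact: fin_num_measure.
Qed.

Definition lebesgue_rV0 : set 'rV[R]_0 -> \bar R := \d_(0 : 'rV[R]_0).
HB.instance Definition _ := Measure.on lebesgue_rV0.
HB.instance Definition _ :=
  Measure_isSigmaFinite.Build _ _ _ lebesgue_rV0 dirac_sigma_finite.

Definition rV_cons n (p : R * 'rV[R]_n) : 'rV[R]_n.+1 := row_mx p.1%:M p.2.
Definition rV_uncons n (v : 'rV[R]_n.+1) : R * 'rV[R]_n :=
  (v ord0 ord0, \row_i v ord0 (lift ord0 i)).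

Lemma rV_consE n (p : R * 'rV[R]_n) i : rV_cons p ord0 i =
  if unlift ord0 i is Some j then p.2 ord0 j else p.1.
Proof.
case: unliftP => [j ->|->].
  transitivity (row_mx (p.1%:M : 'M[R]_1) p.2 ord0 (rshift 1 j)).
    by congr (rV_cons p ord0); exact/val_inj.
  by rewrite row_mxEr.
transitivity (row_mx (p.1%:M : 'M[R]_1) p.2 ord0 (lshift n ord0)).
  by congr (rV_cons p ord0); exact/val_inj.
by rewrite row_mxEl mxE.
Qed.

Lemma rV_consK n : cancel (@rV_cons n) (@rV_uncons n).
Proof.
case=> x v; rewrite /rV_uncons rV_consE unlift_none; congr pair.
by apply/rowP => i; rewrite mxE rV_consE liftK.
Qed.

Lemma measurable_rV_cons n : measurable_fun setT (@rV_cons n).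
Proof.
apply: measurable_fun_rVP => i; under eq_fun do rewrite rV_consE.
case: unlift => [j|]; last exact: measurable_fst.
by apply: (measurableT_comp (measurable_coord j)); exact: measurable_snd.
Qed.

HB.instance Definition _ n := isMeasurableFun.Build _ _ _ _ (@rV_cons n)
  (@measurable_rV_cons n).

Lemma measurable_rV_uncons n : measurable_fun setT (@rV_uncons n).
Proof.
apply/measurable_fun_pair; first exact: measurable_coord.
apply: measurable_fun_rVP => i; under eq_fun do rewrite mxE.
exact: measurable_coord.
Qed.

Section cons.
Context n (mu : {sigma_finite_measure set 'rV[R]_n -> \bar R}).

Definition lebesgue_rVS : set 'rV[R]_n.+1 -> \bar R :=
  pushforward (lebesgue_measure \x mu)%E (@rV_cons n).

Let lebesgue_rVS_0 : lebesgue_rVS set0 = 0%E.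
Proof. by rewrite /lebesgue_rVS /pushforward preimage_set0 measure0. Qed.

Let lebesgue_rVS_ge0 A : (0 <= lebesgue_rVS A)%E.
Proof. by rewrite /lebesgue_rVS /pushforward measure_ge0. Qed.

Let lebesgue_rVS_sigma_additive : semi_sigma_additive lebesgue_rVS.
Proof.
refine (@measure_semi_sigma_additive _ _ _
  (pushforward (lebesgue_measure \x mu)%E (@rV_cons n) :
     {measure set _ -> \bar R})).
exact: measurable_rV_cons.
Qed.

Let lebesgue_rVS_sigma_finite : sigma_finite setT lebesgue_rVS.
Proof.
have /sigma_finiteP[F [TF ndF Foo]] :=
  sigma_finiteT (lebesgue_measure : {sigma_finite_measure set _ -> \bar R}).
have /sigma_finiteP[G [TG ndG Goo]] := sigma_finiteT mu.
exists (fun i => @rV_uncons n @^-1` (F i `*` G i)) => [|i].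
  apply/seteqP; split=> // v _ /=.
  have [i _ Fi] : (\bigcup_i F i) (rV_uncons v).1 by rewrite -TF.
  have [k _ Gk] : (\bigcup_i G i) (rV_uncons v).2 by rewrite -TG.
  exists (maxn i k) => //; split.
    by move: Fi; exact/subsetPset/ndF/leq_maxl.
  by move: Gk; exact/subsetPset/ndG/leq_maxr.
have [mFi Fioo] := Foo i; have [mGi Gioo] := Goo i; split.
  rewrite -[X in measurable X]setTI; apply: measurable_rV_uncons => //.
  exact: measurableX.
rewrite /lebesgue_rVS /pushforward -comp_preimage.
rewrite (_ : _ \o _ = id); last by apply/funext => p; exact: rV_consK.
by rewrite preimage_id product_measure1E// lte_mul_pinfty// ge0_fin_numE.
Qed.



HB.instance Definition _ := isMeasure.Build _ _ _ lebesgue_rVS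
  lebesgue_rVS_0 lebesgue_rVS_ge0 lebesgue_rVS_sigma_additive.
HB.instance Definition _ :=
  Measure_isSigmaFinite.Build _ _ _ lebesgue_rVS lebesgue_rVS_sigma_finite.
End cons.

(* Lebesgue measure on R^n, as an iterated product; on R^0 = {0} it is the unit
   mass, so that integration over R^0 is evaluation at 0. *)
Fixpoint lebesgue_rV n : {sigma_finite_measure set 'rV[R]_n -> \bar R} :=
  if n is m.+1 then lebesgue_rVS (lebesgue_rV m) else lebesgue_rV0.
End lebesgue_rV.

Section complex_integral.
Context d (T : measurableType d) (R : realType).

Definition cmeasurable (D : set T) (f : T -> R[i]) :=
  measurable_fun D (fun x => complex.Re (f x)) /\
  measurable_fun D (fun x => complex.Im (f x)).

Definition cintegral (mu : {measure set T -> \bar R}) (D : set T)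
    (f : T -> R[i]) : R[i] :=
  (\int[mu]_(x in D) complex.Re (f x))%R
    +i* (\int[mu]_(x in D) complex.Im (f x))%R.

End complex_integral.

(* Euclidean ball; the library norm on 'rV[R]_n is the sup norm. *)
Definition eball (R : realType) n (r : R) : set 'rV[R]_n :=
  [set s | Num.sqrt (\sum_i s ord0 i ^+ 2) < r].

(* f is of class C^k on the open set U *)
Fixpoint Ck (R : realType) (k m : nat) (V : normedModType R)
    (U : set 'rV[R]_m) (f : 'rV[R]_m -> V) : Prop :=
  match k with
  | 0 => forall x, U x -> {for x, continuous f}
  | k'.+1 => (forall x, U x -> differentiable f x) /\
      forall i, Ck k' U (fun x => 'D_(delta_mx ord0 i) f x)
  end.

Section manifold.
Context (R : realType) (n : nat) (N : ptopologicalType).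

(* The functions are total; only their values on the domain, resp. on its
   image, are meaningful. *)
Record chart := Chart {
  chart_dom : set N;
  chart_coord : N -> 'rV[R]_n;
  chart_param : 'rV[R]_n -> N }.

Definition is_chart (c : chart) :=
  [/\ open (chart_dom c), open (chart_coord c @` chart_dom c),
      forall x, chart_dom c x -> chart_param c (chart_coord c x) = x,
      forall x, chart_dom c x -> {for x, continuous (chart_coord c)} &
      forall y, (chart_coord c @` chart_dom c) y -> {for y, continuous (chart_param c)}].

Definition C2_transition (c c' : chart) :=
  Ck 2 (chart_coord c @` (chart_dom c `&` chart_dom c')) (chart_coord c' \o chart_param c).

(* The atlas is a maximal C^2 atlas.  gram c x is the matrix of the metric at x
   in the coordinates c; the metric is of class C^1, the highest regularity
   that is invariant under C^2 changes of coordinates.  Tangent vectors are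
   rows, and 'J f y is the matrix acting on the right. *)
Record riemannian_manifold := RiemannianManifold {
  atlas : set chart;
  gram : chart -> N -> 'M[R]_n;
  manifold_hausdorff : hausdorff_space N;
  manifold_second_countable : @second_countable N;
  atlas_chart : forall c, atlas c -> is_chart c;
  atlas_cover : forall x, exists2 c, atlas c & chart_dom c x;
  atlas_transition : forall c c', atlas c -> atlas c' -> C2_transition c c';
  atlas_maximal : forall c, is_chart c ->
    (forall c', atlas c' -> C2_transition c c' /\ C2_transition c' c) ->
    atlas c;
  gram_sym : forall c x, atlas c -> chart_dom c x -> (gram c x)^T = gram c x;
  gram_pos : forall c x (v : 'rV[R]_n), atlas c -> chart_dom c x -> v != 0 ->
    0 < (v *m gram c x *m v^T) ord0 ord0;
  gram_C1 : forall c, atlas c ->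
    Ck 1 (chart_coord c @` chart_dom c) (gram c \o chart_param c);
  gram_transition : forall c c' x, atlas c -> atlas c' ->
    chart_dom c x -> chart_dom c' x ->
    let J := jacobian (chart_coord c' \o chart_param c) (chart_coord c x) in
    gram c x = J *m gram c' x *m J^T }.

Variable g : riemannian_manifold.

Definition chart_at (x : N) : chart := s2val (cid2 (atlas_cover g x)).

Definition speed (gamma : R -> N) (t : R) : R :=
  let c := chart_at (gamma t) in
  let v := 'D_1 (chart_coord c \o gamma) t in
  Num.sqrt ((v *m gram g c (gamma t) *m v^T) ord0 ord0).

Definition C1_arc (gamma : R -> N) := forall t : R, 0 <= t <= 1 ->
  {for t, continuous gamma} /\
  forall c, atlas g c -> chart_dom c (gamma t) ->
    (\forall s \near t, derivable (chart_coord c \o gamma) s 1) /\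
    {for t, continuous (fun s => 'D_1 (chart_coord c \o gamma) s)}.

(* some piecewise C^1 curve from x to y, given as a chain of C^1 arcs, has
   length L *)
Inductive curve_length : N -> N -> \bar R -> Prop :=
| curve_nil x : curve_length x x 0%E
| curve_cons gamma y L : C1_arc gamma -> curve_length (gamma 1) y L ->
    curve_length (gamma 0) y
      (\int[lebesgue_measure]_(t in `[0%R, 1%R]) (speed gamma t)%:E + L)%E.

Definition rdist (x y : N) : \bar R := ereal_inf (curve_length x y).

Definition tube (M : set N) (e : R) : set N :=
  [set x | (ereal_inf [set rdist x y | y in M] < e%:E)%E].

(* In the chart c, S is the slice R^j x {0}; y *m pid_mx j is (y, 0). *)
Definition slice_chart (j : nat) (S : set N) (c : chart) :=
  atlas g c /\ forall x, chart_dom c x ->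
    (S x <-> exists y : 'rV[R]_j, chart_coord c x = y *m pid_mx j).

Definition submanifold (j : nat) (S : set N) := forall x, S x ->
  (j <= n)%N /\ exists2 c, slice_chart j S c & chart_dom c x.

Definition induced_gram (j : nat) (c : chart) (x : N) : 'M[R]_j :=
  pid_mx j *m gram g c x *m (pid_mx j)^T.

(* mu is the j-dimensional Riemannian volume of the submanifold S, extended by
   0 to N.  The case j = n, S = setT is the Riemannian volume of N. *)
Definition riemannian_volume (j : nat) (S : set N)
    (mu : {measure set (borel N) -> \bar R}) :=
  mu (~` S) = 0%E /\
  forall c (A : set (borel N)), slice_chart j S c -> measurable A ->
    A `<=` chart_dom c `&` S ->
    mu A = (\int[lebesgue_rV j]_(y in
                [set y | (chart_coord c @` A) (y *m pid_mx j)])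
             (Num.sqrt (\det (induced_gram j c (chart_param c (y *m pid_mx j)))))%:E)%E.

(* F is of class C^1 on U x B_r, where U is open in the submanifold S of
   dimension j: it is continuous there, and of class C^1 in slice charts of S
   and charts of N. *)
Definition C1_on_product (j d : nat) (S U : set N) (r : R)
    (F : N * 'rV[R]_d -> N) :=
  {within U `*` eball r, continuous F} /\
  forall c c', slice_chart j S c -> atlas g c' ->
    let p := fun w : 'rV[R]_(j + d) => chart_param c (lsubmx w *m pid_mx j) in
    Ck 1 [set w | [/\ (chart_coord c @` (chart_dom c `&` U)) (lsubmx w *m pid_mx j),
                      eball r (rsubmx w) & chart_dom c' (F (p w, rsubmx w))]]
         (fun w => chart_coord c' (F (p w, rsubmx w))).

Variable l : nat.

(* The cell al lies over cell_base al, a subset of the stratum of dimension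
   j = cell_stratum al; its normal variable ranges over R^(n - j). *)
Record cells := Cells {
  cell_radius : R;
  cell : finType;
  cell_stratum : cell -> 'I_l.+1;
  cell_base : cell -> set N;
  cell_nbhd : cell -> set N;
  cell_map : forall al, N * 'rV[R]_(n - cell_stratum al) -> N;
  cell_fibre : forall al, N -> set 'rV[R]_(n - cell_stratum al);
  cell_jac : forall al, N * 'rV[R]_(n - cell_stratum al) -> R }.

Arguments cell_stratum : clear implicits.
Arguments cell_base : clear implicits.
Arguments cell_nbhd : clear implicits.
Arguments cell_map : clear implicits.
Arguments cell_fibre : clear implicits.
Arguments cell_jac : clear implicits.

Definition cell_domain (C : cells) (al : cell C) :
    set (borel N * 'rV[R]_(n - cell_stratum C al)) :=
  [set ps | [/\ cell_base C al ps.1, cell_fibre C al ps.1 ps.2 & eball (cell_radius C) ps.2]].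

Arguments cell_domain : clear implicits.

Definition cell_image (C : cells) (al : cell C) : set N :=
  cell_map C al @` cell_domain C al.
Arguments cell_image : clear implicits.

(* The images of the cell domains are required to be measurable up to null
   sets, as the integrals over them presuppose.  cells_cover identifies the
   region they cover with the tube, up to a null set. *)
Record normal_cells (vol : {measure set (borel N) -> \bar R})
    (Sigma : 'I_l.+1 -> set N)
    (volS : 'I_l.+1 -> {measure set (borel N) -> \bar R})
    (M : set N) (C : cells) : Prop := {
  radius_gt0 : 0 < cell_radius C;
  base_borel : forall al, measurable (cell_base C al : set (borel N));
  base_stratum : forall al, cell_base C al `<=` Sigma (cell_stratum C al);
  base_finite : forall al, (volS (cell_stratum C al) (cell_base C al) < +oo)%E;
  base_disjoint : trivIset setT (cell_base C);
  base_cover : \bigcup_al cell_base C al = M;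
  base_nbhd_open : forall al, exists2 O : set N, open O &
    cell_nbhd C al = O `&` Sigma (cell_stratum C al);
  base_sub_nbhd : forall al, cell_base C al `<=` cell_nbhd C al;
  nmap_C1 : forall al, C1_on_product (cell_stratum C al) (Sigma (cell_stratum C al))
    (cell_nbhd C al) (cell_radius C) (cell_map C al);
  nmap0 : forall al p, cell_nbhd C al p -> cell_map C al (p, 0) = p;
  fibre_measurable : forall al, measurable
    ([set ps | cell_base C al ps.1 /\ cell_fibre C al ps.1 ps.2]
      : set (borel N * 'rV[R]_(n - cell_stratum C al)));
  cell_image_measurable : forall al, exists2 B : set (borel N),
    measurable B & vol.-negligible (B `+` cell_image C al);
  cells_disjoint : forall al be, al <> be ->
    vol.-negligible (cell_image C al `&` cell_image C be);
  cells_cover :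
    vol.-negligible (tube M (cell_radius C) `+` \bigcup_al cell_image C al);
  jac_gt0 : forall al ps, cell_domain C al ps -> 0 < cell_jac C al ps;
  jac_measurable : forall al, measurable_fun (cell_domain C al) (cell_jac C al);
  cell_change_of_variables : forall (al : cell C) (h : borel N -> \bar R),
    measurable_fun [set: borel N] h -> (forall x, 0 <= h x)%E ->
    (\int[vol]_(x in cell_image C al) h x =
     \int[volS (cell_stratum C al)]_(p in cell_base C al)
       \int[lebesgue_rV (n - cell_stratum C al)]_(s in
           cell_fibre C al p `&` eball (cell_radius C))
         (h (cell_map C al (p, s)) * (cell_jac C al (p, s))%:E))%E;
  fibre_codim0 : forall al p, (n - cell_stratum C al = 0)%N -> cell_base C al p ->
    cell_fibre C al p = [set 0];
  jac_codim0 : forall al p, (n - cell_stratum C al = 0)%N -> cell_base C al p ->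
    cell_jac C al (p, 0) = 1 }.

Definition cell_integral (C : cells)
    (volS : 'I_l.+1 -> {measure set (borel N) -> \bar R})
    (f : N -> R) (a : N -> R[i]) (al : cell C) (z : R) : R[i] :=
  cintegral (volS (cell_stratum C al)) (cell_base C al) (fun p =>
    cintegral (lebesgue_rV (n - cell_stratum C al))
      (cell_fibre C al p `&` eball (cell_radius C))
      (fun s => let x := cell_map C al (p, s) in
        a x * (cell_jac C al (p, s))%:C * (expR (- z * f x))%:C)).

End manifold.

(* Main.v *)
(* Up to a null set, N is the disjoint union of the cell images and of a
   measurable set E disjoint from the tube.  On E one has f >= f0 + delta, so
   there |a e^{-zf}| <= e^{-(z - zs)(f0 + delta)} |a| e^{-zs f}, and
   integrability at zs bounds the integral over E.  On a cell image the change
   of variables, known for nonnegative functions, extends to the integrable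
   function a e^{-zf}: the fibre integrals of its positive and negative parts
   are measurable on the base by Tonelli, hence finite almost everywhere.
   So I(z) is the sum of the I_al(z) up to O(e^{-z(f0 + delta)}); divided by
   e^{-zf0} z^{-Qs}, this error and the terms with Q al > Qs tend to 0. *)
Require Import Defs.
From HB Require Import structures.
From mathcomp Require Import all_boot all_order all_algebra.
From mathcomp Require Import all_classical all_reals all_analysis measurable_realfun.
From mathcomp Require Import complex ring.
Import Order.TTheory GRing.Theory Num.Theory.
Import numFieldNormedType.Exports.
Local Open Scope classical_set_scope.
Local Open Scope ring_scope.
Local Open Scope complex_scope.

(** * Integrals over sets that are measurable only up to null sets *)

(* No measurability: the library integral of a nonnegative function is a lower
   integral. *)
Lemma ge0_le_lower_integral d (T : measurableType d) (R : realType)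
    (mu : {measure set T -> \bar R}) (f1 f2 : T -> \bar R) :
  (forall x, 0 <= f1 x)%E -> (forall x, f1 x <= f2 x)%E ->
  (\int[mu]_x f1 x <= \int[mu]_x f2 x)%E.
Proof.
move=> f10 f12; have f20 x : (0 <= f2 x)%E by exact: le_trans (f10 x) (f12 x).
rewrite !ge0_integralTE//; apply: ereal_sup_le => _ [h /= hf1 <-].
by exists h => //= x; exact: le_trans (hf1 x) (f12 x).
Qed.

(* D itself need not be measurable; the cell images are only known to be so up
   to null sets. *)
Lemma ge0_integral_negligibleY d (T : measurableType d) (R : realType)
    (mu : {measure set T -> \bar R}) (B D : set T) (h : T -> \bar R) :
  measurable B -> mu.-negligible (B `+` D) ->
  measurable_fun setT h -> (forall x, 0 <= h x)%E ->
  (\int[mu]_(x in D) h x = \int[mu]_(x in B) h x)%E.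
Proof.
move=> mB [Z [mZ Z0 BDZ]] mh h0.
have mono (A A' : set T) : A `<=` A' ->
    (\int[mu]_(x in A) h x <= \int[mu]_(x in A') h x)%E.
  move=> AA'; rewrite integral_mkcond [leRHS]integral_mkcond.
  apply: ge0_le_lower_integral => x.
    by rewrite erestrict_ge0.
  rewrite !patchE; case: ifPn => xA; first by rewrite mem_set//; exact/AA'/set_mem.
  by case: ifP.
have BZ : (\int[mu]_(x in B `|` Z) h x = \int[mu]_(x in B `\` Z) h x)%E.
  rewrite (@ge0_negligible_integral _ _ _ mu _ Z)//.
  - by rewrite setDUl setDv setU0.
  - exact: measurableU.
  - exact: measurable_funTS.
have BZ' : (\int[mu]_(x in B) h x = \int[mu]_(x in B `\` Z) h x)%E.
  by rewrite (@ge0_negligible_integral _ _ _ mu _ Z)//; exact: measurable_funTS.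
(* [D] lies between [B] minus [Z] and the union of [B] and [Z], and [h] has the same integral over
   these two sets. *)
apply/eqP; rewrite eq_le; apply/andP; split.
  rewrite BZ' -BZ; apply: mono => x Dx.
  have [Bx|nBx] := pselect (B x); [by left|right; apply: BDZ].
  by rewrite setY_def; right.
rewrite BZ'; apply: mono => x [Bx nZx]; apply: contrapT => nDx; apply: nZx.
by apply: BDZ; rewrite setY_def; left.
Qed.

(** * Change of variables, from nonnegative to integrable functions *)

Section disintegration.
Context d d1 d2 (T : measurableType d) (T1 : measurableType d1)
  (T2 : measurableType d2) (R : realType).
Variables (mu : {measure set T -> \bar R}) (nu : {measure set T1 -> \bar R})
  (lam : {sigma_finite_measure set T2 -> \bar R}).
Variables (P : set T1) (S : T1 -> set T2) (F : T1 * T2 -> T) (J : T1 * T2 -> R).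
Let D := [set ps | P ps.1 /\ S ps.1 ps.2].
Hypotheses (mP : measurable P) (mD : measurable D)
  (mF : measurable_fun D F) (mJ : measurable_fun D J)
  (J0 : forall ps, D ps -> 0 <= J ps).

Let A (h : T -> \bar R) p := (\int[lam]_(s in S p) (h (F (p, s)) * (J (p, s))%:E))%E.

(** Tonelli wants an integrand on the whole product, whence the extension [k] by 0 off [D]; for p in
    [P] its section is the fibre integrand extended by 0 off [S p]. *)
Let measurable_A h : measurable_fun setT h -> (forall x, 0 <= h x)%E ->
  measurable_fun P (A h).
Proof.
move=> mh h0; pose k := (fun ps => h (F ps) * (J ps)%:E)%E \_ D.
have mk : measurable_fun setT k.
  have mk0 : measurable_fun D ((h \o F) \* (EFin \o J))%E.
    apply: emeasurable_funM; first exact: (measurableT_comp mh mF).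
    exact/measurable_EFinP.
  exact: (measurable_restrictT _ mD).1 mk0.
have k0 ps : (0 <= k ps)%E.
  by apply: erestrict_ge0 => x Dx; rewrite mule_ge0// lee_fin J0.
apply: (@eq_measurable_fun _ _ _ _ _ (fubini_F lam k)); last first.
  by apply: measurable_funTS; exact: measurable_fun_fubini_tonelli_F.
move=> p; rewrite inE => Pp; rewrite /fubini_F /A [RHS]integral_mkcond.
apply: eq_integral => s _; rewrite /k !patchE.
have [Ss|nSs] := pselect (S p s).
  by rewrite !mem_set.
by rewrite !memNset// => -[].
Qed.

(** The hypothesis applies to the positive and the negative part of [phi]. Their integrals over [B]
    are finite, so both fibre integrals are integrable over [P] and can be subtracted. *)
Lemma Rintegral_disintegration (B : set T) (phi : T -> R) :
  (forall h : T -> \bar R, measurable_fun setT h -> (forall x, 0 <= h x)%E ->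
    \int[mu]_(x in B) h x = \int[nu]_(p in P) A h p)%E ->
  measurable B -> measurable_fun setT phi -> mu.-integrable B (EFin \o phi) ->
  \int[mu]_(x in B) phi x =
  \int[nu]_(p in P) \int[lam]_(s in S p) (phi (F (p, s)) * J (p, s)).
Proof.
move=> hA mB mphi iphi.
pose g := EFin \o phi; have mg : measurable_fun setT g by exact/measurable_EFinP.
have mp := measurable_funepos mg; have mn := measurable_funeneg mg.
have p0 x : (0 <= g^\+ x)%E by [].
have n0 x : (0 <= g^\- x)%E by [].
have hp := hA _ mp p0; have hn := hA _ mn n0.
have mAp := measurable_A _ mp p0; have mAn := measurable_A _ mn n0.
have A0 h p : (forall x, 0 <= h x)%E -> P p -> (0 <= A h p)%E.
  move=> h0 Pp; apply: integral_ge0 => s Ss.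
  by apply: mule_ge0 => //; rewrite lee_fin J0.
have iA h : measurable_fun P (A h) -> (forall x, 0 <= h x)%E ->
    (\int[nu]_(p in P) A h p < +oo)%E -> nu.-integrable P (A h).
  move=> mAh h0 fin; apply/integrableP; split=> //.
  rewrite (eq_integral (A h))// => p; rewrite inE => Pp.
  by rewrite gee0_abs// A0.
have iAp : nu.-integrable P (A g^\+%E).
  by apply: iA => //; rewrite -hp; exact: integral_funepos_lt_pinfty.
have iAn : nu.-integrable P (A g^\-%E).
  by apply: iA => //; rewrite -hn; exact: integral_funeneg_lt_pinfty.
(* Since [J] is nonnegative, the parts of phi J are the parts of phi times J. Both sides pass
   through [fine], so the identity holds at every p of [P], even where a fibre integral is
   infinite. *)
have inner p : P p ->
    \int[lam]_(s in S p) (phi (F (p, s)) * J (p, s)) = fine (A g^\+ p - A g^\- p)%E.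
  move=> Pp; rewrite /Rintegral integralE; congr (fine (_ - _));
    apply: eq_integral => s.
    rewrite inE => Ss; have j0 : 0 <= J (p, s) by exact: J0.
    by rewrite /= !funeposE /g /= -!EFin_max -EFinM maxr_pMl// mul0r.
  rewrite inE => Ss; have j0 : 0 <= J (p, s) by exact: J0.
  by rewrite /= !funenegE /g /= -!EFin_max -EFinM maxr_pMl// mul0r mulNr.
rewrite /Rintegral; congr fine.
rewrite integralE hp hn -integralB//.
apply: ae_eq_integral => //.
- exact: emeasurable_funB.
- apply/measurable_EFinP; apply: (@eq_measurable_fun _ _ _ _ _
    (fun p => fine (A g^\+ p - A g^\- p)%E)).
    by move=> p; rewrite inE => Pp; rewrite -inner.
  apply: measurableT_comp; first exact: fine_measurable.
  exact: emeasurable_funB.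
(* Almost everywhere both fibre integrals are finite, and there [fine] loses nothing. *)
have := integrable_ae mP iAp; have := integrable_ae mP iAn.
apply: filterS2 => p fn fp Pp.
rewrite -[LHS]fineK; first by congr EFin; exact/esym/inner.
by rewrite fin_numB fp// fn.
Qed.

End disintegration.

(** * Borel measurability on the product of N with a Euclidean space *)

Lemma borel_open (T : ptopologicalType) (U : set T) :
  open U -> measurable (U : set (borel T)).
Proof. exact: sub_sigma_algebra. Qed.

Lemma continuous_borel_measurable (R : realType) (T : ptopologicalType)
  (f : T -> R) : continuous f -> measurable_fun [set: borel T] f.
Proof.
move=> /continuousP cf; apply: (measurability _ (RGenOpens.measurableE R)).
move=> _ [_ [a [b ->] <-]]; rewrite setTI; apply: borel_open.
exact/cf/interval_open.
Qed.

Section open_product.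
Context (R : realType) (N : ptopologicalType) (d : nat).
Hypothesis N2 : @second_countable N.

Let box (q : 'rV[rat]_d) (k : nat) : set 'rV[R]_d :=
  [set v | forall i, ball (ratr (q ord0 i) : R) k.+1%:R^-1 (v ord0 i)].

Let measurable_box q k : measurable (box q k).
Proof.
rewrite (_ : box q k = \bigcap_(i in [set: 'I_d])
    ((fun v : 'rV[R]_d => v ord0 i) @^-1` ball (ratr (q ord0 i) : R) k.+1%:R^-1)).
  apply: fin_bigcap_measurable => // i _; rewrite -[X in measurable X]setTI.
  by apply: measurable_coord => //; exact: measurable_ball.
by apply/seteqP; split=> v /=; [move=> h i _; exact: h|move=> h i; exact: h].
Qed.

(** A box of half-width at most e / 2 with rational centre near [v] stays in the sup-norm ball of
    radius e about [v], by the triangle inequality through the centre. *)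
Let box_nbhs (v : 'rV[R]_d) (V : set 'rV[R]_d) : nbhs v V ->
  exists q k, box q k v /\ box q k `<=` V.
Proof.
move=> /nbhs_ballP[e /= e0 eV].
have [k /ltW ke] : exists k : nat, k.+1%:R^-1 < e / 2.
  have [k _ /(_ k (leqnn k))] :=
    near_infty_natSinv_lt (PosNum (divr_gt0 e0 (ltr0n R 2))).
  by exists k.
have k0 : 0 < k.+1%:R^-1 :> R by rewrite invr_gt0.
have /choice[q hq] : forall i : 'I_d, exists r,
    ball (ratr r : R) k.+1%:R^-1 (v ord0 i).
  move=> i.
  have [|r] := @rat_in_itvoo R (v ord0 i - k.+1%:R^-1) (v ord0 i + k.+1%:R^-1).
    by rewrite ltrD2l gtrN.
  rewrite in_itv /= => vr; exists r.
  by rewrite /ball/= distrC ltr_distlC.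
exists (\row_i q i), k; split=> [i|w wb]; first by rewrite mxE.
apply: eV; split=> // i j; rewrite ord1.
rewrite (splitr e); apply: (@ball_triangle _ _ (ratr (q j) : R)).
  by apply/ball_sym; exact: (le_ball ke (hq j)).
by apply: (le_ball ke); have := wb j; rewrite mxE.
Qed.

(** By second countability, products of a basic open set and a rational box form a countable family
    of measurable rectangles; [W] is the union of those that it contains. *)
Lemma open_prod_measurable (W : set (N * 'rV[R]_d)) :
  open W -> measurable (W : set (borel N * 'rV[R]_d)).
Proof.
move=> oW; have [B cB [Bo Bb]] := N2.
have WB (x : N) (v : 'rV[R]_d) : W (x, v) ->
    exists U q k, [/\ B U, U x, box q k v & U `*` box q k `<=` W].
  move=> Wxv; have : nbhs (x, v) W by exact: open_nbhs_nbhs.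
  case=> -[A V] [/= nA nV] AVW.
  have [U [BU Ux] UA] := Bb x A nA.
  have [q [k [qkv qkV]]] := box_nbhs _ _ nV.
  by exists U, q, k; split=> // -[y w] [/UA Ay /qkV Vw]; exact: AVW.
(* A countable base is empty or the image of a surjection [e] from [nat]. *)
have /pfcard_geP[B0|/unsquash e] : (B #<= [set: nat])%card by exact: cB.
  rewrite (_ : W = set0)//; apply/seteqP; split=> // -[x v] /WB[U [q [k []]]].
  by rewrite B0.
pose G (nqk : nat * ('rV[rat]_d * nat)) : set (borel N * 'rV[R]_d) :=
  let Y := e nqk.1 `*` box nqk.2.1 nqk.2.2 in
  if `[< Y `<=` W >] then Y else set0.
rewrite (_ : W = \bigcup_i G i).
  apply: countable_bigcupT_measurable => // -[m [q k]]; rewrite /G /=.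
  case: ifP => // _; apply: measurableX => //.
  by apply: borel_open; apply: Bo; exact: funS.
apply/seteqP; split=> [[x v] /WB[U [q [k [BU Ux qkv UW]]]]|].
  have [m _ mU] : [set e m | m in [set: nat]] U by exact: surj.
  by exists (m, (q, k)) => //; rewrite /G /= mU asboolT.
by move=> [x v] [i _]; rewrite /G; case: ifP => // /asboolP; exact.
Qed.

(** On [E] the preimage of an open set is the trace of an open set [V] of the product, so on [D] it
    is the trace of [V], which is measurable. *)
Lemma within_continuous_measurable (D E : set (N * 'rV[R]_d))
    (F : N * 'rV[R]_d -> N) :
  measurable (D : set (borel N * 'rV[R]_d)) -> D `<=` E ->
  {within E, continuous F} ->
  @measurable_fun _ _ (borel N * 'rV[R]_d)%type (borel N) D F.
Proof.
move=> mD DE /continuousP cF.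
apply: (@measurability _ _ (borel N * 'rV[R]_d)%type (borel N) D F (@open N) erefl).
move=> _ [U oU <-]; have /open_subspaceP[V oV VE] := cF _ oU.
rewrite (_ : D `&` _ = D `&` V).
  by apply: measurableI => //; exact: open_prod_measurable.
have VE' x : (V `&` E) x <-> U (F x) /\ E x by rewrite VE.
apply/seteqP; split=> x [Dx h]; split=> //.
  by have [_ []] := VE' x; first (by split; [|exact: DE]).
by have [[]] := VE' x; first (by split; [|exact: DE]).
Qed.

End open_product.

Lemma measurable_eball (R : realType) d (r : R) : measurable (@eball R d r).
Proof.
have mf : measurable_fun setT (fun s : 'rV[R]_d => Num.sqrt (\sum_i s ord0 i ^+ 2)).
  apply: (@measurableT_comp _ _ _ _ _ _ (@Num.sqrt R)).
    by apply: continuous_measurable_fun; exact: sqrt_continuous.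
  apply: measurable_sum => i; apply: measurable_funX; exact: measurable_coord.
rewrite (_ : eball r = setT `&`
    (fun s : 'rV[R]_d => Num.sqrt (\sum_i s ord0 i ^+ 2)) @^-1` `]-oo, r[).
  exact: mf.
by rewrite setTI; apply/seteqP; split=> s /=; rewrite in_itv.
Qed.

(** * Decay of powers and exponentials, and leading terms of weighted sums *)

Lemma powRN_cvg0 (R : realType) (q : R) : 0 < q -> z `^ (- q) @[z --> +oo] --> 0.
Proof.
move=> q0; apply/cvgr0Pnorm_lt => e e0.
near=> z; have z0 : 0 < z by near: z; exact: nbhs_pinfty_gt.
rewrite ger0_norm ?powR_ge0// /powR gt_eqF// -[ltRHS]lnK// ltr_expR.
(* The inequality amounts to z > exp(- ln e / q). *)
rewrite mulNr ltrNl -ltr_pdivrMl// -ltr_expR lnK//.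
Unshelve. all: by end_near. Qed.

(** For z >= 1 one has z^q <= z^(k+1), and the Taylor term of order k+2 bounds exp(zd) from below by
    (zd)^(k+2) / (k+2)!. The quotient is at most c / z. *)
Lemma powR_expRN_cvg0 (R : realType) (q d : R) : 0 < d ->
  z `^ q * expR (- (z * d)) @[z --> +oo] --> 0.
Proof.
(* The Archimedean bound is available for nonnegative numbers, while [q] may be negative; hence the
   maximum with 0. *)
move=> d0; pose k := Num.bound (Num.max 0 q); pose c := (k.+2)`!%:R / d ^+ k.+2.
have qk : q <= k.+1%:R.
  have m0 : 0 <= Num.max 0 q by rewrite le_max lexx.
  rewrite (@le_trans _ _ (Num.max 0 q)) ?le_max ?lexx ?orbT//.
  by rewrite (le_trans (ltW (archi_boundP m0)))// ler_nat.
have c0 : 0 <= c by rewrite divr_ge0 ?exprn_ge0 ?ltW.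
apply: (@squeeze_cvgr _ _ _ _ (cst 0) (fun z => c * z `^ (- 1))); last 2 first.
- exact: cvg_cst.
- by rewrite -[X in _ --> X](mulr0 c); apply: cvgMr; exact: powRN_cvg0.
near=> z; have z1 : 1 <= z by near: z; exact: nbhs_pinfty_ge.
have z0 : 0 < z by exact: lt_le_trans z1.
rewrite mulr_ge0 ?powR_ge0 ?expR_ge0//=.
rewrite powR_inv1 ?(ltW z0)// expRN.
rewrite ler_pdivrMr ?expR_gt0//.
apply: (@le_trans _ _ (z ^+ k.+1)); first by rewrite -powR_mulrn ?(ltW z0)// ler_powR.
have : (z * d) ^+ k.+2 / (k.+2)`!%:R <= expR (z * d).
  apply: le_trans (@expR_ge1Dxn _ _ k.+1 _); first by rewrite lerDr.
  by rewrite mulr_ge0// ltW.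
move=> /(ler_wpM2l (divr_ge0 c0 (ltW z0))); apply: le_trans.
rewrite exprMn [z ^+ k.+2]exprSr /c le_eqVlt; apply/orP; left; apply/eqP.
have f0 : (k.+2)`!%:R != 0 :> R by rewrite pnatr_eq0 -lt0n fact_gt0.
have d0' : d ^+ k.+2 != 0 by rewrite expf_neq0 ?gt_eqF.
by field; rewrite f0 d0' gt_eqF.
Unshelve. all: by end_near. Qed.

(** In the application [w j] is z^(Qs - Q j), which tends to 1 if Q j = Qs and to 0 otherwise: only
    the terms of minimal exponent survive. *)
Lemma weighted_sum_cvg (K : numFieldType) (T : Type) (F : set_system T)
    {FF : Filter F} (J : finType) (A : pred J) (w r : J -> T -> K^o)
    (k : J -> K^o) :
  (forall j, w j x @[x --> F] --> ((A j)%:R : K^o)) ->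
  (forall j, r j x @[x --> F] --> (0 : K^o)) ->
  (\sum_j w j x * (k j + r j x)) @[x --> F] --> (\sum_(j | A j) k j : K^o).
Proof.
move=> wA r0; rewrite [X in _ --> X]big_mkcond/=.
apply: cvg_big => [|j _]; first exact: add_continuous.
rewrite (_ : (if A j then k j else 0) = (A j)%:R * (k j + 0)); last first.
  by rewrite addr0; case: (A j); rewrite ?mul1r ?mul0r.
apply: cvgM; first exact: wA.
by apply: cvgD; [exact: cvg_cst|exact: r0].
Qed.

(** After division by [lead] the difference tends to 0. Measuring the error against [lead] alone
    keeps the estimate meaningful when the limiting sum vanishes, so both final cases follow from
    it. *)
Lemma leading_term (K : numFieldType) (T : Type) (F : set_system T)
    {FF : Filter F} (J : finType) (A : pred J) (w r : J -> T -> K^o)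
    (k : J -> K^o) (lead D f : T -> K^o) :
  (forall j, w j x @[x --> F] --> ((A j)%:R : K^o)) ->
  (forall j, r j x @[x --> F] --> (0 : K^o)) ->
  (\forall x \near F, lead x != 0) ->
  D x / lead x @[x --> F] --> (0 : K^o) ->
  (\forall x \near F, f x = lead x * (\sum_j w j x * (k j + r j x)) + D x) ->
  forall eps, 0 < eps ->
    \forall x \near F, `|f x - lead x * (\sum_(j | A j) k j)| <= eps * `|lead x|.
Proof.
move=> wA r0 lead0 D0 fE eps eps0.
have cvg0 : (\sum_j w j x * (k j + r j x)) - (\sum_(j | A j) k j)
    + D x / lead x @[x --> F] --> (0 : K^o).
  rewrite [X in _ --> X](_ : 0 = \sum_(j | A j) k j - \sum_(j | A j) k j + 0).
    apply: cvgD => //; apply: cvgB; last exact: cvg_cst.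
    exact: weighted_sum_cvg.
  by rewrite subrr addr0.
have he := cvgr0_norm_le _ cvg0 _ eps0.
near=> x.
have -> : f x = lead x * (\sum_j w j x * (k j + r j x)) + D x by near: x.
have l0 : lead x != 0 by near: x.
have -> : lead x * (\sum_j w j x * (k j + r j x)) + D x
    - lead x * (\sum_(j | A j) k j) =
  lead x * ((\sum_j w j x * (k j + r j x)) - (\sum_(j | A j) k j) + D x / lead x).
  by field.
by rewrite normrM mulrC ler_wpM2r//; near: x; exact: he.
Unshelve. all: by end_near. Qed.

(** * Asymptotics of complex-valued functions *)

Section complex_asymptotics.
Variable R : realType.
Implicit Types f : R -> R[i]^o.

Lemma normc_real (x : R) : `|x%:C| = `|x|%:C.
Proof. by rewrite normc_def /= expr0n addr0 sqrtr_sqr. Qed.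

Lemma le_normcDReIm (x : R[i]) : `|x| <= (`|complex.Re x| + `|complex.Im x|)%:C.
Proof.
rewrite normc_def lecR -[leRHS]ger0_norm ?addr_ge0// -sqrtr_sqr ler_wsqrtr//.
rewrite -[complex.Re x ^+ 2]real_normK ?num_real//.
rewrite -[complex.Im x ^+ 2]real_normK ?num_real// sqrrD -addrA lerD2l.
by rewrite lerDr mulrn_wge0 ?mulr_ge0.
Qed.

(** The order of [R[i]] compares only numbers with equal imaginary parts, so a positive epsilon is
    real and complex limits reduce to real estimates. *)
Lemma gt0_complexE (e : R[i]) : 0 < e -> 0 < complex.Re e /\ e = (complex.Re e)%:C.
Proof.
case: e => a b; rewrite ltcE /= => /andP[/eqP -> a0]; by split.
Qed.

Lemma complex_cvg0 f (u : R -> R) :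
  (\forall z \near +oo, `|f z| <= (u z)%:C) -> u z @[z --> +oo] --> 0 ->
  f z @[z --> +oo] --> (0 : R[i]^o).
Proof.
move=> fu u0; apply/cvgr0Pnorm_lt => eps /gt0_complexE[e0 epsE]; rewrite epsE.
have ue := cvgr0_norm_lt _ u0 _ e0.
near=> z; have fz : `|f z| <= (u z)%:C by near: z; exact: fu.
apply: le_lt_trans fz _; rewrite ltcR; apply: le_lt_trans (ler_norm _) _.
by near: z; exact: ue.
Unshelve. all: by end_near. Qed.

(** Factoring out [lead] leaves the weights z^(Qs - Q j). In the error divided by [lead] the factors
    exp(-z f0) cancel, which leaves the bound c z^Qs exp(-zd). *)
Lemma laplace_leading_term (J : finType) (Q : J -> R) (K : J -> R[i])
    (r : J -> R -> R[i]^o) (Qs f0 d c : R) (F : R -> R[i]^o) :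
  0 < d -> (forall j, Qs <= Q j) ->
  (forall j, r j z @[z --> +oo] --> (0 : R[i]^o)) ->
  (\forall z \near +oo,
    `|F z - (expR (- z * f0))%:C * \sum_j (z `^ (- Q j))%:C * (K j + r j z)|
      <= (c * expR (- z * (f0 + d)))%:C) ->
  let lead z := (expR (- z * f0) * z `^ (- Qs))%:C in
  forall eps : R[i], 0 < eps -> \forall z \near +oo,
    `|F z - lead z * (\sum_(j | Q j == Qs) K j)| <= eps * `|lead z|.
Proof.
move=> d0 Qmin r0 FD lead.
have lead0 z : 0 < z -> lead z != 0.
  move=> z0; rewrite /lead -[0]/(0%:C) (inj_eq (@complexI R)).
  by rewrite gt_eqF// mulr_gt0 ?expR_gt0 ?powR_gt0.
pose D z : R[i]^o :=
  F z - (expR (- z * f0))%:C * \sum_j (z `^ (- Q j))%:C * (K j + r j z).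
have H := @leading_term R[i] R +oo _ J (fun j => Q j == Qs)
  (fun j z => (z `^ (Qs - Q j))%:C) r K lead D F.
apply: H.
- move=> j; have [->|QQ] := eqVneq (Q j) Qs.
    by rewrite subrr; under eq_cvg do rewrite powRr0; exact: cvg_cst.
  apply: (@complex_cvg0 _ (fun z => z `^ (- (Q j - Qs)))).
    by near=> z; rewrite normc_real lecR ger0_norm ?powR_ge0// opprB.
  by apply: powRN_cvg0; rewrite subr_gt0 lt_neqAle eq_sym QQ Qmin.
- exact: r0.
- by near=> z; apply: lead0; near: z; exact: nbhs_pinfty_gt.
- apply: (@complex_cvg0 _ (fun z => c * (z `^ Qs * expR (- (z * d))))); last first.
    by rewrite -[X in _ --> X](mulr0 c); apply: cvgMr; exact: powR_expRN_cvg0.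
  near=> z; have z0 : 0 < z by near: z; exact: nbhs_pinfty_gt.
  have Dz : `|D z| <= (c * expR (- z * (f0 + d)))%:C by near: z; exact: FD.
  have leadE : `|lead z| = (expR (- z * f0) * z `^ (- Qs))%:C.
    by rewrite normc_real ger0_norm// mulr_ge0 ?expR_ge0 ?powR_ge0.
  rewrite normrM normfV leadE.
  rewrite ler_pdivrMr ?ltcR ?mulr_gt0 ?expR_gt0 ?powR_gt0//.
  rewrite -rmorphM /= (le_trans Dz)// lecR.
  have -> : c * (z `^ Qs * expR (- (z * d))) * (expR (- z * f0) * z `^ (- Qs)) =
      c * (expR (- (z * d)) * expR (- z * f0)) * (z `^ Qs * z `^ (- Qs)) by ring.
  rewrite -powRD; last by rewrite subrr eqxx /= gt_eqF.
  by rewrite subrr powRr0 mulr1 -expRD mulrDr addrC !mulNr.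
near=> z; have z0 : 0 < z by near: z; exact: nbhs_pinfty_gt.
rewrite /D (_ : lead z * _ =
    (expR (- z * f0))%:C * \sum_j (z `^ (- Q j))%:C * (K j + r j z)).
  by rewrite addrC subrK.
rewrite /lead rmorphM /= -mulrA mulr_sumr; congr (_ * _).
apply: eq_bigr => j _; rewrite mulrA -rmorphM /= -powRD; last first.
  by rewrite [z == 0]gt_eqF// implybT.
by rewrite addrA addNr add0r.
Unshelve. all: by end_near. Qed.

End complex_asymptotics.

(** * Integrals over finite families of almost disjoint sets *)

Lemma Rintegral_negligible d (T : measurableType d) (R : realType)
    (mu : {measure set T -> \bar R}) (D Z : set T) (phi : T -> R) :
  measurable Z -> measurable D -> mu.-integrable D (EFin \o phi) -> mu Z = 0%E ->
  \int[mu]_(x in D) phi x = \int[mu]_(x in D `\` Z) phi x.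
Proof. by move=> mZ mD iphi Z0; congr fine; exact: negligible_integral. Qed.

(** Removing [Z] makes the pieces disjoint and changes no integral; additivity then follows by
    induction on a list of indices without repetition. *)
Lemma Rintegral_split d (T : measurableType d) (R : realType)
    (mu : {measure set T -> \bar R}) (I : finType) (B : I -> set T) (Z : set T)
    (phi : T -> R) :
  (forall i, measurable (B i)) -> measurable Z -> mu Z = 0%E ->
  (forall i j, i <> j -> B i `&` B j `<=` Z) ->
  mu.-integrable setT (EFin \o phi) ->
  \int[mu]_x phi x = \sum_i \int[mu]_(x in B i) phi x +
    \int[mu]_(x in ~` (\bigcup_i B i `|` Z)) phi x.
Proof.
move=> mB mZ Z0 BZ iphi.
have iS A : measurable A -> mu.-integrable A (EFin \o phi).
  by move=> mA; exact: integrableS iphi.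
pose U (s : seq I) := \big[setU/set0]_(i <- s) (B i `\` Z).
have mU s : measurable (U s).
  by apply: bigsetU_measurable => i _; exact: measurableD.
have mE : measurable (~` (\bigcup_i B i `|` Z)).
  by apply/measurableC/measurableU => //; exact: fin_bigcup_measurable.
have sumU s : uniq s ->
    \int[mu]_(x in U s) phi x = \sum_(i <- s) \int[mu]_(x in B i) phi x.
  elim: s => [_|i s ih /= /andP[iNs us]].
    by rewrite /U !big_nil Rintegral_set0.
  rewrite /U !big_cons -/(U s) Rintegral_setU//; last 3 first.
  - exact: measurableD.
  - by apply: iS; apply: measurableU => //; exact: measurableD.
  - apply/disj_setPS => x [[Bix nZx]]; rewrite /U -bigcup_seq => -[j /= js [Bjx _]].
    apply: nZx; apply: (BZ i j) => // ij; by rewrite ij js in iNs.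
  by rewrite ih// -Rintegral_negligible//; exact: iS.
rewrite (@Rintegral_negligible _ _ _ _ _ Z)//.
have -> : setT `\` Z = U (index_enum I) `|` ~` (\bigcup_i B i `|` Z).
  rewrite /U -bigcup_seq; apply/seteqP; split=> x; last first.
    by case=> [[i _ [_ nZ]]|/not_orP[]].
  move=> [_ nZ].
  have [[i _ Bi]|nB] := pselect ((\bigcup_i B i) x); last by right=> -[].
  by left; exists i => //=; rewrite mem_index_enum.
rewrite Rintegral_setU//; last 2 first.
- by apply: iS; exact: measurableU.
- apply/disj_setPS => x []; rewrite /U -bigcup_seq => -[i _ [Bi _]] /not_orP[nB _].
  by apply: nB; exists i.
by rewrite sumU// index_enum_uniq.
Qed.

Lemma normr_Rintegral_le d (T : measurableType d) (R : realType)
    (mu : {measure set T -> \bar R}) (E : set T) (phi w : T -> R) (c : R) :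
  measurable E -> mu.-integrable E (EFin \o phi) -> mu.-integrable E (EFin \o w) ->
  (forall x, E x -> `|phi x| <= c * w x) ->
  `|\int[mu]_(x in E) phi x| <= c * \int[mu]_(x in E) w x.
Proof.
move=> mE iphi iw le; rewrite (le_trans (le_normr_Rintegral mE iphi))//.
rewrite -RintegralZl//; apply: le_Rintegral => //.
  exact: integrable_norm.
exact: (integrableZl mE c iw).
Qed.

Lemma negligible_fin_bigcup d (T : measurableType d) (R : realType)
    (mu : {measure set T -> \bar R}) (I : finType) (A : I -> set T) :
  (forall i, mu.-negligible (A i)) -> mu.-negligible (\bigcup_i A i).
Proof.
move=> nA; have -> : \bigcup_i A i = \big[setU/set0]_(i <- index_enum I) A i.
  rewrite -bigcup_seq; apply/seteqP; split=> x [i _ Aix]; exists i => //=.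
  by rewrite mem_index_enum.
by apply: (big_ind mu.-negligible) => //; [exact: negligible_set0|exact: negligibleU].
Qed.

(** * Localization of the integral to the normal cells *)

Section normal_cells.
Context (R : realType) (n : nat) (N : ptopologicalType)
  (g : riemannian_manifold R n N) (vol : {measure set (borel N) -> \bar R})
  (l : nat) (Sigma : 'I_l.+1 -> set N)
  (volS : 'I_l.+1 -> {measure set (borel N) -> \bar R})
  (M : set N) (C : cells R n N l).
Local Notation fibre al := (@cell_fibre R n N l C al).
Local Notation F al := (@cell_map R n N l C al).
Local Notation J al := (@cell_jac R n N l C al).
Local Notation domain al := (@cell_domain R n N l C al).
Hypothesis hC : normal_cells g vol Sigma volS M C.

(** [B] is a measurable substitute for the cell image. Integrals of nonnegative functions over the
    two sets agree, which carries the change of variables over to [B]. *)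
Lemma cell_Rintegral (al : cell C) (B : set (borel N)) (phi : borel N -> R) :
  measurable B -> vol.-negligible (B `+` cell_image al) ->
  measurable_fun setT phi -> vol.-integrable B (EFin \o phi) ->
  \int[vol]_(x in B) phi x =
  \int[volS (cell_stratum al)]_(p in cell_base al)
    \int[lebesgue_rV (n - cell_stratum al)]_(s in
        fibre al p `&` eball (cell_radius C))
      (phi (F al (p, s)) * J al (p, s)).
Proof.
move=> mB nB mphi iphi.
pose S p := fibre al p `&` eball (cell_radius C).
have domE : [set ps : borel N * 'rV[R]_(n - cell_stratum al) |
    cell_base al ps.1 /\ S ps.1 ps.2] = domain al.
  by apply/seteqP; split=> ps; [case=> ? []|case=> ? ? ?].
have mD : measurable (domain al).
  rewrite -domE (_ : [set _ | _] =
    [set ps : borel N * 'rV[R]_(n - cell_stratum al) |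
      cell_base al ps.1 /\ fibre al ps.1 ps.2] `&` (setT `*` eball (cell_radius C))).
    apply: measurableI; first exact: (fibre_measurable hC).
    by apply: measurableX => //; exact: measurable_eball.
  by apply/seteqP; split=> ps; [case=> ? []|case=> -[? ?] []].
apply: (@Rintegral_disintegration _ _ _ (borel N) (borel N) _ _ vol
  (volS (cell_stratum al)) (lebesgue_rV _) _ S) => //.
- exact: (base_borel hC).
- by rewrite domE.
(* The cell map is continuous on [cell_nbhd] times the ball, which contains the cell domain. *)
- rewrite domE; have [cF _] := nmap_C1 hC al.
  apply: within_continuous_measurable cF => //.
    exact: manifold_second_countable g.
  by move=> ps [Pp _ sb]; split=> //; exact: (base_sub_nbhd hC).
- by rewrite domE; exact: (jac_measurable hC).
- by rewrite domE => ps Dps; apply/ltW/(jac_gt0 hC).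
- move=> h mh h0; rewrite -(cell_change_of_variables hC)//.
  by apply/esym; exact: ge0_integral_negligibleY.
Qed.

(** One null set [Z] absorbs all defects: off [Z] the cell images coincide with the measurable sets
    [B al], are disjoint and fill exactly the tube. [E] is chosen before [phi], so the same [E]
    serves all z. *)
Lemma cell_decomposition : exists E : set (borel N),
  [/\ measurable E, forall x, E x -> ~ tube g M (cell_radius C) x &
  forall phi : borel N -> R, measurable_fun setT phi ->
    vol.-integrable setT (EFin \o phi) ->
    \int[vol]_x phi x =
    \sum_al \int[volS (cell_stratum al)]_(p in cell_base al)
      \int[lebesgue_rV (n - cell_stratum al)]_(s in
          fibre al p `&` eball (cell_radius C))
        (phi (F al (p, s)) * J al (p, s)) +
    \int[vol]_(x in E) phi x].
Proof.
have /choice[B mB] : forall al : cell C, exists B : set (borel N),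
    measurable B /\ vol.-negligible (B `+` cell_image al).
  by move=> al; have [B] := cell_image_measurable hC al; exists B.
pose W1 al := B al `+` cell_image al.
(* The diagonal is emptied, as only distinct cells have negligible overlap. *)
pose W2 (al be : cell C) : set (borel N) :=
  if al == be then set0 else cell_image al `&` cell_image be.
pose W3 : set (borel N) :=
  tube g M (cell_radius C) `+` \bigcup_(al : cell C) cell_image al.
have [Z [mZ Z0 WZ]] : vol.-negligible
    (\bigcup_al W1 al `|` \bigcup_al (\bigcup_be W2 al be) `|` W3).
  apply: negligibleU; last exact: (cells_cover hC).
  apply: negligibleU; apply: negligible_fin_bigcup => al; first exact: (mB al).2.
  apply: negligible_fin_bigcup => be; rewrite /W2; case: eqP => [_|].
    exact: negligible_set0.
  exact: (cells_disjoint hC).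
have imB al x : ~ Z x -> B al x <-> cell_image al x.
  move=> nZx; split=> [Bx|ix]; apply: contrapT => nx; apply: nZx; apply: WZ;
    left; left; exists al => //; rewrite /W1 setY_def; [by left|by right].
exists (~` (\bigcup_al B al `|` Z)); split.
- apply/measurableC/measurableU => //; apply: fin_bigcup_measurable => //.
  by move=> al _; exact: (mB al).1.
- move=> x /not_orP[nB nZ] tx; apply: (nZ); apply: WZ; right.
  rewrite /W3 setY_def; left; split=> // -[al _ ix]; apply: nB; exists al => //.
  exact/imB.
move=> phi mphi iphi; rewrite (@Rintegral_split _ _ _ vol _ B Z)//.
- congr (_ + _); apply: eq_bigr => al _; apply: cell_Rintegral => //.
  + exact: (mB al).1.
  + exact: (mB al).2.
  + by apply: integrableS iphi => //; exact: (mB al).1.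
- by move=> al; exact: (mB al).1.
- move=> al be albe x [Ba Bb]; apply: contrapT => nZ; apply: (nZ); apply: WZ.
  left; right; exists al => //; exists be => //; rewrite /W2; case: eqP => // _.
  by split; apply/imB.
Qed.

(** The bound for the remainder involves the integral of [w] over [E], taken at the fixed exponent
    [zs]; hence [c] does not depend on z. *)
Lemma laplace_localization (f : N -> R) (a : N -> R[i]) (f0 d zs : R) :
  continuous f -> cmeasurable ([set: borel N]) a -> (forall x, f0 <= f x) ->
  (\int[vol]_x (Normc.normc (a x) * expR (- zs * f x))%:E < +oo)%E ->
  (forall x, ~ tube g M (cell_radius C) x -> f0 + d <= f x) ->
  exists c, \forall z \near +oo,
    `|cintegral vol setT (fun x => a x * (expR (- z * f x))%:C)
        - \sum_(al : cell C) cell_integral volS f a al z|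
      <= (c * expR (- z * (f0 + d)))%:C.
Proof.
move=> cf [mRe mIm] f0f iw sep.
have [E [mE Etube decomp]] := cell_decomposition.
have mf : measurable_fun [set: borel N] f by exact: continuous_borel_measurable.
pose w x := Normc.normc (a x) * expR (- zs * f x).
have mexp z : measurable_fun [set: borel N] (fun x => expR (- z * f x)).
  apply: measurableT_comp; first exact: measurable_expR.
  exact: measurable_funM.
have normcE x : Normc.normc (a x) =
    Num.sqrt (complex.Re (a x) ^+ 2 + complex.Im (a x) ^+ 2) by case: (a x).
have mw : measurable_fun [set: borel N] w.
  apply: measurable_funM => //; under eq_fun do rewrite normcE.
  apply: (@measurableT_comp _ _ _ _ _ _ (@Num.sqrt R)).
    by apply: continuous_measurable_fun; exact: sqrt_continuous.
  by apply: measurable_funD; exact: measurable_funX.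
have w0 x : 0 <= w x by rewrite mulr_ge0 ?expR_ge0// normcE sqrtr_ge0.
have int_w : vol.-integrable setT (EFin \o w).
  apply/integrableP; split; first exact/measurable_EFinP.
  by under eq_integral do rewrite /= ger0_norm//.
pose part (u : N -> R) z x := u x * expR (- z * f x).
(* Used twice: b = f0 on all of N gives integrability, b = f0 + d on [E] gives the decay of the
   remainder. *)
have part_le (u : N -> R) z b x : `|u x| <= Normc.normc (a x) -> zs <= z ->
    b <= f x -> `|part u z x| <= expR (- (z - zs) * b) * w x.
  move=> ua zsz bf; rewrite normrM (ger0_norm (expR_ge0 _)) mulrCA -expRD.
  apply: ler_pM; rewrite ?expR_ge0// ler_expR.
  rewrite -[- z](_ : - (z - zs) - zs = - z); last by ring.
  by rewrite mulrDl lerD2r ler_wnM2l// oppr_le0 subr_ge0.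
have part_measurable u z : measurable_fun [set: borel N] u ->
    measurable_fun [set: borel N] (part u z).
  by move=> mu; apply: measurable_funM.
have part_integrable (u : N -> R) z : measurable_fun [set: borel N] u ->
    (forall x, `|u x| <= Normc.normc (a x)) -> zs <= z ->
    vol.-integrable setT (EFin \o part u z).
  move=> mu ua zsz.
  apply: (@le_integrable _ (borel N) R vol setT measurableT (EFin \o part u z)
      (EFin \o (fun x => expR (- (z - zs) * f0) * w x))).
  - by apply/measurable_EFinP; exact: part_measurable.
  - move=> x _; rewrite /= lee_fin [leRHS]ger0_norm.
      by apply: part_le => //; exact: ua.
    by rewrite mulr_ge0 ?expR_ge0 ?w0.
  - exact: (integrableZl measurableT _ int_w).
have iE h : vol.-integrable setT (EFin \o h) -> vol.-integrable E (EFin \o h).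
  by move=> ih; exact: integrableS ih.
have part_remainder (u : N -> R) z : measurable_fun [set: borel N] u ->
    (forall x, `|u x| <= Normc.normc (a x)) -> zs <= z ->
    `|\int[vol]_(x in E) part u z x| <=
      expR (- (z - zs) * (f0 + d)) * \int[vol]_(x in E) w x.
  move=> mu ua zsz; apply: normr_Rintegral_le => //.
  - exact/iE/part_integrable.
  - exact: iE.
  - by move=> x Ex; apply: part_le => //; exact/sep/Etube.
have Re_le x : `|complex.Re (a x)| <= Normc.normc (a x).
  by rewrite normcE -sqrtr_sqr ler_wsqrtr// lerDl sqr_ge0.
have Im_le x : `|complex.Im (a x)| <= Normc.normc (a x).
  by rewrite normcE -sqrtr_sqr ler_wsqrtr// lerDr sqr_ge0.
have part_split (u : N -> R) z : measurable_fun [set: borel N] u ->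
    (forall x, `|u x| <= Normc.normc (a x)) -> zs <= z ->
    \int[vol]_x part u z x -
      \sum_al \int[volS (cell_stratum al)]_(p in cell_base al)
        \int[lebesgue_rV (n - cell_stratum al)]_(s in
            fibre al p `&` eball (cell_radius C))
          (part u z (F al (p, s)) * J al (p, s)) = \int[vol]_(x in E) part u z x.
  move=> mu ua zsz; rewrite decomp.
  - by rewrite addrC addKr.
  - exact: part_measurable.
  - exact: part_integrable.
(* The 2 counts the real and imaginary parts; the exponential comes from splitting -(z - zs)(f0 +
   d). *)
exists (2 * expR (zs * (f0 + d)) * \int[vol]_(x in E) w x).
near=> z.
have zsz : zs <= z by near: z; apply: nbhs_pinfty_ge; exact: num_real.
rewrite (_ : _ - _ =
    (\int[vol]_(x in E) part (@complex.Re R \o a) z x) +i*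
    (\int[vol]_(x in E) part (@complex.Im R \o a) z x)).
  rewrite (le_trans (le_normcDReIm _ _))// lecR /=.
  have -> : 2 * expR (zs * (f0 + d)) * \int[vol]_(x in E) w x
      * expR (- z * (f0 + d)) =
    (expR (- (z - zs) * (f0 + d)) * \int[vol]_(x in E) w x) +
    (expR (- (z - zs) * (f0 + d)) * \int[vol]_(x in E) w x).
    rewrite (_ : - (z - zs) * (f0 + d) = zs * (f0 + d) + - z * (f0 + d)) ?expRD.
      by ring.
    by ring.
  apply: lerD; first exact: (part_remainder _ _ mRe Re_le zsz).
  exact: (part_remainder _ _ mIm Im_le zsz).
(* The factors [cell_jac] and exp(-zf) are real, so the complex iterated integrals are componentwise
   integrals of [part]. *)
have ReM (x : R[i]) (y : R) : complex.Re (x * y%:C) = complex.Re x * y.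
  by case: x => x1 x2 /=; rewrite mulr0 subr0.
have ImM (x : R[i]) (y : R) : complex.Im (x * y%:C) = complex.Im x * y.
  by case: x => x1 x2 /=; rewrite mulr0 add0r.
have ReB (x y : R[i]) : complex.Re (x - y) = complex.Re x - complex.Re y.
  by case: x; case: y.
have ImB (x y : R[i]) : complex.Im (x - y) = complex.Im x - complex.Im y.
  by case: x; case: y.
have ReD : {morph @complex.Re R : x y / x + y} by case=> ? ? [].
have ImD : {morph @complex.Im R : x y / x + y} by case=> ? ? [].
apply/eqP; rewrite eq_complex; apply/andP; split; apply/eqP => /=.
  rewrite -(part_split _ _ mRe Re_le zsz) ReB (big_morph _ ReD erefl); congr (_ - _).
    by apply: eq_Rintegral => x _; rewrite ReM.
  apply: eq_bigr => al _; apply: eq_Rintegral => p _ /=.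
  by apply: eq_Rintegral => s _; rewrite !ReM /part /= mulrAC.
rewrite -(part_split _ _ mIm Im_le zsz) ImB (big_morph _ ImD erefl); congr (_ - _).
  by apply: eq_Rintegral => x _; rewrite ImM.
apply: eq_bigr => al _; apply: eq_Rintegral => p _ /=.
by apply: eq_Rintegral => s _; rewrite !ImM /part /= mulrAC.
Unshelve. all: by end_near. Qed.

End normal_cells.

(** * Assembly of the expansion and its two cases *)

Theorem theorem3p23
  (R : realType) (n : nat) (N : ptopologicalType)
  (g : riemannian_manifold R n N)
  (vol : {measure set (borel N) -> \bar R})
  (hvol : riemannian_volume g n setT vol)
  (f : N -> R) (hf : continuous f) (hf_lb : has_lbound (range f))
  (a : N -> R[i]) (ha : cmeasurable ([set: borel N]) a)
  (f0 : R) (hf0 : f0 = inf (range f))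
  (M : set N) (hM : M = [set x | f x = f0])
  (hM0 : M !=set0) (hMc : compact M)
  (l : nat) (Sigma : 'I_l.+1 -> set N)
  (hSigma : forall j : 'I_l.+1, submanifold g j (Sigma j))
  (hSigma_disj : trivIset setT Sigma)
  (hSigma_cover : \bigcup_j Sigma j = M)
  (volS : 'I_l.+1 -> {measure set (borel N) -> \bar R})
  (hvolS : forall j : 'I_l.+1, riemannian_volume g j (Sigma j) (volS j))
  (zs : R) (hzs : 0 < zs)
  (hint : (\int[vol]_x (Normc.normc (a x) * expR (- zs * f x))%:E < +oo)%E)
  (eps0 : R) (heps0 : 0 < eps0) (delta : R -> R)
  (hsep : forall e : R, 0 < e < eps0 ->
     0 < delta e /\ forall x, ~ tube g M e x -> f0 + delta e <= f x)
  (C : cells R n N l) (hC : normal_cells g vol Sigma volS M C)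
  (heps : cell_radius C < eps0)
  (Q : cell C -> R) (K : cell C -> R[i])
  (hQ : forall al, 0 <= Q al)
  (hI : forall al, exists2 r : R -> R[i]^o,
     r z @[z --> +oo] --> (0 : R[i]^o) &
     \forall z \near +oo, cell_integral volS f a al z =
       (expR (- z * f0))%:C * (z `^ (- Q al))%:C * (K al + r z))
  (Qs : R) (hQs_min : (exists al, Q al = Qs) /\ forall al, Qs <= Q al) :
  let I : R -> R[i]^o :=
    fun z => cintegral vol setT (fun x => a x * (expR (- z * f x))%:C) in
  let Ks : R[i] := \sum_(al | Q al == Qs) K al in
  let lead : R -> R[i]^o := fun z => (expR (- z * f0) * z `^ (- Qs))%:C in
  [/\ exists2 r : cell C -> R -> R[i]^o,
        forall al, r al z @[z --> +oo] --> (0 : R[i]^o) &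
        I = (fun z => (expR (- z * f0))%:C *
               \sum_al (z `^ (- Q al))%:C * (K al + r al z) : R[i]^o)
            +O_ +oo (fun z => (expR (- z * (f0 + delta (cell_radius C))))%:C : R[i]^o),
      Ks != 0 -> I ~_ +oo (fun z => lead z * Ks : R[i]^o) &
      Ks = 0 -> I =o_ +oo lead].
Proof.
move=> I Ks lead.
have f0f x : f0 <= f x by rewrite hf0; apply: ge_inf => //; exists x.
have [d0 sep] : 0 < delta (cell_radius C) /\ forall x, ~ tube g M (cell_radius C) x ->
    f0 + delta (cell_radius C) <= f x.
  by apply: hsep; rewrite (radius_gt0 hC).
have [c hc] := laplace_localization _ _ _ _ _ _ _ _ _ _ hC _ _ _ _ _ hf ha f0f hint sep.
have /choice[r hr] : forall al, exists r : R -> R[i]^o,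
    r z @[z --> +oo] --> (0 : R[i]^o) /\
    \forall z \near +oo, cell_integral volS f a al z =
       (expR (- z * f0))%:C * (z `^ (- Q al))%:C * (K al + r z).
  by move=> al; have [r] := hI al; exists r.
have r0 al : r al z @[z --> +oo] --> (0 : R[i]^o) by have [] := hr al.
(* There are finitely many cells, so the expansions hold simultaneously for large z. *)
have nearI : \forall z \near +oo, forall al, cell_integral volS f a al z =
    (expR (- z * f0))%:C * (z `^ (- Q al))%:C * (K al + r al z).
  by apply: filter_forall => al; have [] := hr al.
have FD : \forall z \near +oo, `|I z - (expR (- z * f0))%:C *
    \sum_al (z `^ (- Q al))%:C * (K al + r al z)|
    <= (c * expR (- z * (f0 + delta (cell_radius C))))%:C.
  near=> z.
  have Iz : forall al, cell_integral volS f a al z =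
    (expR (- z * f0))%:C * (z `^ (- Q al))%:C * (K al + r al z) by near: z.
  have -> : (expR (- z * f0))%:C * \sum_al (z `^ (- Q al))%:C * (K al + r al z) =
      \sum_(al : cell C) cell_integral volS f a al z.
    by rewrite mulr_sumr; apply: eq_bigr => al _; rewrite Iz mulrA.
  by near: z; exact: hc.
have main := laplace_leading_term _ _ Q K r Qs f0 _ c I d0 hQs_min.2 r0 FD.
split.
- exists r => //; apply/eqaddOP/bigO_exP.
  (* This constant is positive, as required, and at least [c]. *)
  exists (`|c|%:C + 1); first by rewrite ltr_wpDl// ler0c.
  near=> z; apply: (@le_trans _ _ (c * expR (- z * (f0 + delta (cell_radius C))))%:C).
    by near: z; exact: FD.
  rewrite rmorphM normc_real (ger0_norm (expR_ge0 _)) ler_wpM2r ?ler0c ?expR_ge0//.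
  by rewrite -[leLHS]addr0 lerD// lecR ler_norm.
- move=> Ks0; apply/eqaddoP => e e0.
  have nK : 0 < `|Ks| by rewrite normr_gt0.
  (* Tolerance e |Ks| relative to [lead] is tolerance e relative to lead times Ks. *)
  have mainK := main _ (mulr_gt0 e0 nK).
  near=> z; rewrite normrM [`|lead z| * _]mulrC mulrA.
  by near: z; exact: mainK.
- move=> Ks0; apply/eqoP => e e0; have maine := main _ e0.
  (* With Ks = 0, the subtracted term of [main] is zero. *)
  near=> z; rewrite -[I z]subr0 -(mulr0 (lead z)) -Ks0.
  by near: z; exact: maine.
Unshelve. all: by end_near. Qed.
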